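(* Let $R$ be a ring with $\frac{1}{2}\in R$ (i.e. $2$ is invertible in $R$), and let $a\in R$. Then the following are equivalent: (1) $a\in R$ has Hirano inverse. (2) There exists $p\in comm^2(a)$ with $p^3=p$ such that $a-p\in N(R)$. (3) There exist two idempotents $e,f\in comm^2(a)$ such that $a+e-f\in N(R)$.
   Context: All rings are associative with identity. $N(R)$ denotes the set of all nilpotent elements of $R$. An element $a\in R$ has Hirano inverse if there exists $b\in R$ such that $a^2-ab\in N(R)$, $ab=ba$ and $b=bab$. The double commutant of $a\in R$ is $comm^2(a)=\{x\in R : xy=yx \text{ for every } y\in R \text{ with } ay=ya\}$. *)

(* Defs.v *)
From mathcomp Require Import all_boot all_algebra.
Set Implicit Arguments.
Unset Strict Implicit.
Unset Printing Implicit Defensive.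
Import GRing.Theory.
Local Open Scope ring_scope.

(* [pzRingType] rather than [nzRingType]: rings are associative and unital, and
   the zero ring is allowed. *)

Definition is_nilpotent (R : pzRingType) (x : R) : Prop :=
  exists n : nat, x ^+ n = 0.

Definition is_idempotent (R : pzRingType) (e : R) : Prop := e * e = e.

Definition is_hirano_inverse (R : pzRingType) (a b : R) : Prop :=
  [/\ is_nilpotent (a ^+ 2 - a * b), GRing.comm a b & b = b * a * b].

Definition has_hirano_inverse (R : pzRingType) (a : R) : Prop :=
  exists b : R, is_hirano_inverse a b.

Definition in_comm2 (R : pzRingType) (a x : R) : Prop :=
  forall y : R, GRing.comm a y -> GRing.comm x y.

(* [GRing.unit] is not available on a [pzRingType]. *)
Definition is_invertible (R : pzRingType) (x : R) : Prop :=
  exists y : R, x * y = 1 /\ y * x = 1.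

(* Main.v *)
Require Import Defs.
From HB Require Import structures.
From mathcomp Require Import all_boot all_algebra.
From mathcomp Require Import ring boolp.
Import GRing.Theory.
Local Open Scope ring_scope.

(** All three conditions are equivalent to the nilpotency of [a - a ^+ 3].

    If [b] is a Hirano inverse of [a], then [a ^+ 2] differs from the idempotent
    [a * b] by a nilpotent commuting with it; hence [a ^+ 2 - a ^+ 4] is
    nilpotent, and so is [a - a ^+ 3], whose square is a multiple of it
    ([hirano_inverse_nilpotent_subX3]).  Conversely, once 2 is invertible, the
    polynomial [X ^ 3 - X] is separable, so a root of it modulo nilpotents lifts
    to a true root [p] by Newton's method ([tripotent_lift]).  The iterates are
    polynomials in [a], and therefore [p] lies in the double commutant of [a].

    From a tripotent [p] with [a - p] nilpotent, a Hirano inverse is obtained by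
    inverting [a] on the summand cut out by the idempotent [p ^+ 2], where [a] is
    [p] times a unipotent element ([tripotent_hirano_inverse]).  Finally,
    tripotents are the differences of commuting idempotents: [p] is split into
    its eigenvalue 1 and eigenvalue -1 parts, which again needs 1/2
    ([tripotent_idempotents], [sub_idempotents_tripotent]).

    Each of these computations involves pairwise commuting elements only, so it
    is done in a commutative ring: the bicommutant of a commuting set [S] is a
    commutative subring containing [S], it reflects nilpotency, and it contains
    1/2.  With [S] reduced to [a], it is exactly the double commutant of [a], so
    that membership in [comm^2(a)] comes for free. *)

(** * Tripotents modulo nilpotents in a commutative ring *)

Section NilpotentCom.
Context {C : comPzRingType}.
Implicit Types x y a b p h : C.

Lemma nilpotentM {x} y : is_nilpotent x -> is_nilpotent (x * y).
Proof. by case=> n xn0; exists n; rewrite exprMn xn0 mul0r. Qed.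

Lemma nilpotentD x y :
  is_nilpotent x -> is_nilpotent y -> is_nilpotent (x + y).
Proof.
case=> m xm0 [n yn0]; exists (m + n)%N; rewrite exprDn big1 // => i _.
(* Either the exponent of x is at least m or the exponent of y is at least n. *)
case: (leqP n i) => [/subnK <- | /ltnW lt_in].
  by rewrite exprD yn0 !mulr0 mul0rn.
by rewrite -addnBA // exprD xm0 !mul0r mul0rn.
Qed.

Lemma nilpotent_sqr x : is_nilpotent (x ^+ 2) -> is_nilpotent x.
Proof. by case=> n x2n0; exists (2 * n)%N; rewrite exprM. Qed.

(** The inverse is the geometric series, which is finite here. *)
Lemma invertible_sub1 x : is_nilpotent x -> exists v, (1 - x) * v = 1.
Proof.
case=> n xn0; exists (\sum_(i < n) x ^+ i).
by rewrite -opprB mulNr -subrX1 xn0 sub0r opprK.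
Qed.

(** Modulo the nilpotent [a ^+ 2 - a * b], the element [a ^+ 2] is the
    idempotent [a * b], so [a ^+ 2 * (1 - a ^+ 2)] vanishes and with it the
    square of [a - a ^+ 3]. *)
Lemma hirano_inverse_nilpotent_subX3 a b :
  is_hirano_inverse a b -> is_nilpotent (a - a ^+ 3).
Proof.
case=> nil_w _ /esym bab; apply: nilpotent_sqr.
have -> : (a - a ^+ 3) ^+ 2
  = (a ^+ 2 - a * b) * ((1 - a ^+ 2 - a * b) * (1 - a ^+ 2)) by ring: bab.
exact: nilpotentM.
Qed.

(** Newton's method for [X ^ 3 - X].  Each step replaces the defect
    [a - a ^+ 3] by a multiple of its square, and moves [a] by a nilpotent, so
    the defect is 0 after finitely many steps. *)
Lemma tripotent_lift h a : 2%:R * h = 1 -> is_nilpotent (a - a ^+ 3) ->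
  exists2 p, p ^+ 3 = p & is_nilpotent (a - p).
Proof.
move=> h2 [k0 nil_a].
have [k] : exists k, (a - a ^+ 3) ^+ (2 ^ k) = 0.
  exists k0; rewrite -(subnK (ltnW (ltn_expl k0 (ltnSn 1)))) exprD.
  by rewrite nil_a mulr0.
elim: k a {k0 nil_a} => [|k IHk] a nil_a.
  exists a; last by exists 1%N; rewrite subrr expr1.
  by apply/esym/subr0_eq; move: nil_a; rewrite expn0 expr1.
(* At the roots 0, 1 and -1 the values of [3 / 2 * X ^ 2 - 1] are -1, 1/2 and
   1/2: it is the inverse of the derivative [3 * X ^ 2 - 1] modulo [X ^ 3 - X]. *)
pose n := a - a ^+ 3; pose a1 := a + n * (3%:R * h * a ^+ 2 - 1).
have a1E : exists c, a1 - a1 ^+ 3 = n ^+ 2 * c.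
  (* Expanding gives [n ^+ 2 * c] exactly, up to the relation [2 * h = 1]. *)
  pose c := 9%:R * h * a - (3%:R * h * a ^+ 2 - 1) ^+ 2
    * (3%:R * a + n * (3%:R * h * a ^+ 2 - 1)).
  exists c; have -> : a1 - a1 ^+ 3
    = n ^+ 2 * c + 3%:R * n * a ^+ 2 * (1 - 2%:R * h).
    by rewrite /c /a1 /n; ring.
  by rewrite h2 subrr mulr0 addr0.
have [|p p3 nil_p] := IHk a1.
  by case: a1E => c ->; rewrite exprMn -exprM -expnS nil_a mul0r.
exists p => //; have -> : a - p = n * (1 - 3%:R * h * a ^+ 2) + (a1 - p).
  by rewrite /a1; ring.
by apply: nilpotentD nil_p; apply: nilpotentM; exists (2 ^ k.+1)%N.
Qed.

(** Since [p ^+ 2] acts as 1 on [p], one has [a * p = p ^+ 2 * u] with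
    [u = 1 + (a - p) * p] unipotent.  Thus [p / u] inverts [a] on the summand
    given by [p ^+ 2], and [a * (p / u) = p ^+ 2] is the idempotent sought. *)
Lemma tripotent_hirano_inverse a p : p ^+ 3 = p -> is_nilpotent (a - p) ->
  exists b, is_hirano_inverse a b.
Proof.
move=> p3 nil_w.
(* [v] is the inverse of [u]. *)
have [v uv1] : exists v, (1 - (a - p) * - p) * v = 1.
  exact/invertible_sub1/nilpotentM.
have abE : a * (p * v) = p ^+ 2.
  have -> : a * (p * v) = p ^+ 2 * ((1 - (a - p) * - p) * v)
    + (p - p ^+ 3) * (a - p) * v by ring.
  by rewrite uv1 p3 subrr !mul0r mulr1 addr0.
exists (p * v); split; last 2 first.
- exact: mulrC.
- by rewrite -mulrA abE; ring: p3.
rewrite abE; have -> : a ^+ 2 - p ^+ 2 = (a - p) * (a + p) by ring.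
exact: nilpotentM.
Qed.

(** [(p ^+ 2 - p) / 2] and [(p ^+ 2 + p) / 2] are the Lagrange interpolation
    polynomials at -1 and 1 for the nodes 0, 1, -1, that is, the projections
    onto the eigenvalues -1 and 1 of [p]. *)
Lemma tripotent_idempotents h p :
  2%:R * h = 1 -> p ^+ 3 = p ->
  [/\ is_idempotent (h * (p ^+ 2 - p)), is_idempotent (h * (p ^+ 2 + p))
    & h * (p ^+ 2 + p) - h * (p ^+ 2 - p) = p].
Proof.
move=> h2 p3; rewrite /is_idempotent.
have half x : h * (2%:R * x) = x by rewrite mulrA (mulrC h) h2 mul1r.
have p4 : p ^+ 4 = p ^+ 2 by rewrite exprS p3.
split.
- rewrite mulrACA -mulrA; congr (h * _).
  by rewrite -[RHS]half; congr (h * _); ring: p3 p4.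
- rewrite mulrACA -mulrA; congr (h * _).
  by rewrite -[RHS]half; congr (h * _); ring: p3 p4.
- by rewrite -[RHS]half; ring.
Qed.

End NilpotentCom.

(** * The bicommutant of a commuting set as a commutative ring *)

Section Bicommutant.
Context {R : pzRingType}.
Implicit Types (S : R -> Prop) (x y : R).

Definition in_bicommutant S x : Prop :=
  forall y, (forall s, S s -> GRing.comm s y) -> GRing.comm x y.

(** A boolean copy of [in_bicommutant], in the form that subtypes and subring
    structures require. *)
Definition bicommutant S : {pred R} := fun x => `[< in_bicommutant S x >].

Lemma bicommutantP S x : reflect (in_bicommutant S x) (x \in bicommutant S).
Proof. exact: asboolP. Qed.

Lemma sub_bicommutant S x : S x -> x \in bicommutant S.
Proof. by move=> Sx; apply/bicommutantP => y; apply. Qed.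

Lemma bicommutant_subring S : subring_closed (bicommutant S).
Proof.
split=> [|x y /bicommutantP xS /bicommutantP yS|
          x y /bicommutantP xS /bicommutantP yS];
  apply/bicommutantP => z zS; apply: commr_sym.
- exact: commr1.
- by apply: commrB; apply: commr_sym; [apply: xS | apply: yS].
- by apply: commrM; apply: commr_sym; [apply: xS | apply: yS].
Qed.

(** The type carries the proof [hS] that [S] is commuting, so that its
    commutative ring structure can be inferred. *)
Record bicomm S (hS : forall s t, S s -> S t -> GRing.comm s t) :=
  Bicomm { bicomm_val :> R; bicomm_valP : bicomm_val \in bicommutant S }.

End Bicommutant.
Arguments bicomm {R S} hS.
Arguments Bicomm {R S hS}.

Section BicommutantRing.
Context {R : pzRingType} {S : R -> Prop}.
Context (hS : forall s t, S s -> S t -> GRing.comm s t).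

HB.instance Definition _ := [isSub for @bicomm_val R S hS].
HB.instance Definition _ := [Choice of bicomm hS by <:].
HB.instance Definition _ := GRing.SubChoice_isSubPzRing.Build R (bicommutant S)
  (bicomm hS) (bicommutant_subring S).

(** Every [y] in the bicommutant commutes with [S], because [S] itself does;
    so every [x] in the bicommutant commutes with [y]. *)
Lemma bicomm_mulC : commutative (@GRing.mul (bicomm hS)).
Proof.
move=> x y; apply: val_inj; rewrite !rmorphM.
have /bicommutantP xS := valP x; have /bicommutantP yS := valP y.
by apply: xS => s Ss; apply/commr_sym/yS => t St; apply: hS.
Qed.
HB.instance Definition _ :=
  GRing.PzRing_hasCommutativeMul.Build (bicomm hS) bicomm_mulC.

Lemma bicomm_nilpotent (x : bicomm hS) :
  is_nilpotent x <-> is_nilpotent (val x).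
Proof.
split=> -[n xn0]; exists n; first by rewrite -rmorphXn xn0 rmorph0.
by apply: val_inj; rewrite rmorphXn xn0 rmorph0.
Qed.

(** The inverse of the central element 2 is central, hence in every
    bicommutant. *)
Lemma bicomm_half : is_invertible (2%:R : R) ->
  exists h : bicomm hS, 2%:R * h = 1.
Proof.
case=> h [h2 h2'].
have hZ : h \in bicommutant S.
  apply/bicommutantP => y _.
  rewrite /GRing.comm; have -> : h * y = h * (y * 2%:R) * h.
    by rewrite -!mulrA h2 mulr1.
  by rewrite (commr_nat y 2) !mulrA h2' mul1r.
by exists (Bicomm h hZ); apply: val_inj; rewrite rmorphM rmorph_nat rmorph1.
Qed.

End BicommutantRing.

(** * Transfer to arbitrary rings *)

Section Hirano.
Context {R : pzRingType}.
Implicit Types a b p e f : R.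

Lemma comm_eq1 a (s t : R) : s = a -> t = a -> GRing.comm s t.
Proof. by move=> -> ->. Qed.

Lemma comm_eq2 a b : GRing.comm a b ->
  forall s t : R, s = a \/ s = b -> t = a \/ t = b -> GRing.comm s t.
Proof. by move=> ab s t [] -> [] -> //; apply: commr_sym. Qed.

Lemma in_comm2P a x : in_comm2 a x <-> x \in bicommutant (eq^~ a).
Proof.
split=> [xa|/bicommutantP xa y ay]; last by apply: xa => s ->.
by apply/bicommutantP => y ay; apply: xa; apply: ay.
Qed.

(** The computation takes place in the bicommutant of the pair formed by [a] and
    its inverse [b]: there is no need to know beforehand that [b] commutes with
    everything that commutes with [a]. *)
Lemma hirano_subX3 a : has_hirano_inverse a -> is_nilpotent (a - a ^+ 3).
Proof.
case=> b [nil_w ab bab].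
pose A : bicomm (comm_eq2 a b ab) :=
  Bicomm a (sub_bicommutant _ a (or_introl erefl)).
pose B : bicomm (comm_eq2 a b ab) :=
  Bicomm b (sub_bicommutant _ b (or_intror erefl)).
have /bicomm_nilpotent : is_nilpotent (A - A ^+ 3).
  apply: (@hirano_inverse_nilpotent_subX3 _ A B); split.
  - by apply/bicomm_nilpotent; rewrite rmorphB rmorphXn rmorphM.
  - exact: mulrC.
  - by apply: val_inj; rewrite !rmorphM.
by rewrite rmorphB rmorphXn.
Qed.

(** The lift is carried out inside the bicommutant of [a], which is what puts
    [p] in the double commutant. *)
Lemma subX3_tripotent a : is_invertible (2%:R : R) ->
  is_nilpotent (a - a ^+ 3) ->
  exists p, [/\ in_comm2 a p, p ^+ 3 = p & is_nilpotent (a - p)].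
Proof.
move=> two_inv nil_a.
have [h h2] := bicomm_half (comm_eq1 a) two_inv.
pose A : bicomm (comm_eq1 a) := Bicomm a (sub_bicommutant (eq^~ a) a erefl).
have [|p p3 nil_p] := tripotent_lift h A h2.
  by apply/bicomm_nilpotent; rewrite rmorphB rmorphXn.
exists (val p); split; first by apply/in_comm2P; apply: valP.
  by rewrite -rmorphXn p3.
by move/bicomm_nilpotent: nil_p; rewrite rmorphB.
Qed.

Lemma tripotent_hirano a p : in_comm2 a p -> p ^+ 3 = p ->
  is_nilpotent (a - p) -> has_hirano_inverse a.
Proof.
move=> /in_comm2P pa p3 nil_w.
pose A : bicomm (comm_eq1 a) := Bicomm a (sub_bicommutant (eq^~ a) a erefl).
pose P : bicomm (comm_eq1 a) := Bicomm p pa.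
have [||b [nil_b ab bab]] := @tripotent_hirano_inverse _ A P.
- by apply: val_inj; rewrite rmorphXn.
- by apply/bicomm_nilpotent; rewrite rmorphB.
exists (val b); split.
- by move/bicomm_nilpotent: nil_b; rewrite rmorphB rmorphXn rmorphM.
- by have := congr1 val ab; rewrite !rmorphM.
- by rewrite {1}bab !rmorphM.
Qed.

Lemma tripotent_split a p : is_invertible (2%:R : R) ->
  in_comm2 a p -> p ^+ 3 = p ->
  exists e f, [/\ is_idempotent e, is_idempotent f, in_comm2 a e, in_comm2 a f
    & f - e = p].
Proof.
move=> two_inv /in_comm2P pa p3.
have [h h2] := bicomm_half (comm_eq1 a) two_inv.
pose P : bicomm (comm_eq1 a) := Bicomm p pa.
have [|ee ff fe] := tripotent_idempotents h P h2.
  by apply: val_inj; rewrite rmorphXn.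
exists (val (h * (P ^+ 2 - P))), (val (h * (P ^+ 2 + P))); split.
- by rewrite /is_idempotent -rmorphM ee.
- by rewrite /is_idempotent -rmorphM ff.
- by apply/in_comm2P; apply: valP.
- by apply/in_comm2P; apply: valP.
- by rewrite -rmorphB fe.
Qed.

Lemma sub_idempotents_tripotent e f : GRing.comm e f ->
  is_idempotent e -> is_idempotent f -> (f - e) ^+ 3 = f - e.
Proof.
move=> ef ee ff.
pose E : bicomm (comm_eq2 e f ef) :=
  Bicomm e (sub_bicommutant _ e (or_introl erefl)).
pose F : bicomm (comm_eq2 e f ef) :=
  Bicomm f (sub_bicommutant _ f (or_intror erefl)).
have EE : E * E = E by apply: val_inj; rewrite rmorphM.
have FF : F * F = F by apply: val_inj; rewrite rmorphM.
have /(congr1 val) : (F - E) ^+ 3 = F - E by ring: EE FF.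
by rewrite rmorphXn rmorphB.
Qed.

End Hirano.

Theorem theorem3p3 (R : pzRingType) (h2 : is_invertible (2%:R : R)) (a : R) :
  (has_hirano_inverse a <->
   exists p : R, [/\ in_comm2 a p, p ^+ 3 = p & is_nilpotent (a - p)])
  /\
  (has_hirano_inverse a <->
   exists e f : R,
     [/\ is_idempotent e, is_idempotent f, in_comm2 a e, in_comm2 a f
       & is_nilpotent (a + e - f)]).
Proof.
have iff2 : has_hirano_inverse a <->
    exists p : R, [/\ in_comm2 a p, p ^+ 3 = p & is_nilpotent (a - p)].
  split=> [/hirano_subX3|[p [ap p3 nil_p]]]; first exact: subX3_tripotent.
  exact: tripotent_hirano ap p3 nil_p.
split=> //; rewrite iff2; split.
  case=> p [ap p3 nil_p].
  have [e [f [ee ff ae af fe]]] := tripotent_split a p h2 ap p3.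
  by exists e, f; split=> //; rewrite -addrA -[e - f]opprB fe.
case=> e [f [ee ff ae af nil_ef]]; exists (f - e); split.
- move=> y ay; apply/commr_sym/commrB; apply/commr_sym; first exact: af.
  exact: ae.
- apply: sub_idempotents_tripotent ee ff.
  by apply: ae; apply/commr_sym; apply: af.
- by rewrite opprB addrA.
Qed.
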